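(* Let $\mathbf{w}^{(k)}\in\mathbb{R}^{R(m+n+p)}$ be the point at the $k$-th iteration, with associated factor matrices $\mathbf{X}=[\mathbf{x}_1,\ldots,\mathbf{x}_R]\in\mathbb{R}^{m\times R}$, $\mathbf{Y}=[\mathbf{y}_1,\ldots,\mathbf{y}_R]\in\mathbb{R}^{n\times R}$, $\mathbf{Z}=[\mathbf{z}_1,\ldots,\mathbf{z}_R]\in\mathbb{R}^{p\times R}$, and let $\mathbf{A}=\mathbf{J}_f(\mathbf{w}^{(k)})$ be the Jacobian matrix of the residual map $f$ at $\mathbf{w}^{(k)}$. Given any vector $\mathbf{v}\in\mathbb{R}^{R(m+n+p)}$, write $$\mathbf{v}=\begin{bmatrix}vec(\mathbf{V}_X)\\vec(\mathbf{V}_Y)\\vec(\mathbf{V}_Z)\end{bmatrix}$$ where $\mathbf{V}_X\in\mathbb{R}^{m\times R}$, $\mathbf{V}_Y\in\mathbb{R}^{n\times R}$, $\mathbf{V}_Z\in\mathbb{R}^{p\times R}$. Then $$\mathbf{A}^T\mathbf{A}\cdot\mathbf{v}=\begin{bmatrix} vec\left(\mathbf{V}_X\Pi_X\right)+vec\left(\mathbf{X}\left(\Pi_{XY}\ast(\mathbf{V}_Y^T\mathbf{Y})\right)\right)+vec\left(\mathbf{X}\left(\Pi_{XZ}\ast(\mathbf{V}_Z^T\mathbf{Z})\right)\right)\\ vec\left(\mathbf{Y}\left(\Pi_{XY}\ast(\mathbf{V}_X^T\mathbf{X})\right)\right)+vec\left(\mathbf{V}_Y\Pi_Y\right)+vec\left(\mathbf{Y}\left(\Pi_{YZ}\ast(\mathbf{V}_Z^T\mathbf{Z})\right)\right)\\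 vec\left(\mathbf{Z}\left(\Pi_{XZ}\ast(\mathbf{V}_X^T\mathbf{X})\right)\right)+vec\left(\mathbf{Z}\left(\Pi_{YZ}\ast(\mathbf{V}_Y^T\mathbf{Y})\right)\right)+vec\left(\mathbf{V}_Z\Pi_Z\right) \end{bmatrix}.$$
   Context: Let $m,n,p,R$ be positive integers and let $\mathcal{T}\in\mathbb{R}^{m\times n\times p}$ be a fixed tensor with entries $\mathcal{T}_{ijk}$. A vector $\mathbf{w}\in\mathbb{R}^{R(m+n+p)}$ is identified with a triple of factor matrices $\mathbf{X}\in\mathbb{R}^{m\times R}$, $\mathbf{Y}\in\mathbb{R}^{n\times R}$, $\mathbf{Z}\in\mathbb{R}^{p\times R}$ by $\mathbf{w}=\begin{bmatrix}vec(\mathbf{X})\\vec(\mathbf{Y})\\vec(\mathbf{Z})\end{bmatrix}$, where $vec$ stacks the columns of a matrix, the first column at the top. The residual map $f:\mathbb{R}^{R(m+n+p)}\to\mathbb{R}^{mnp}$, $f=(f_{111},f_{112},\ldots,f_{mnp})$, is defined by $f_{ijk}(\mathbf{w})=\mathcal{T}_{ijk}-\sum_{r=1}^R x_{ir}y_{jr}z_{kr}$, and $\mathbf{J}_f(\mathbf{w})$ is its $mnp\times R(m+n+p)$ Jacobian matrix, with columns ordered as the coordinates of $\mathbf{w}$. The points $\mathbf{w}^{(k)}$ are iterates of a damped Gauss-Newton method for minimizing $F=\frac12\|f\|^2$ started from an arbitrary point. $\ast$ denotes the Hadamard (entrywise) product of two matrices of the same shape, and $\langle\cdot,\cdot\rangle$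 is the Euclidean inner product. The $R\times R$ matrices $\Pi_X,\Pi_Y,\Pi_Z,\Pi_{XY},\Pi_{XZ},\Pi_{YZ}$ have $(r,s)$ entries $$(\Pi_X)_{rs}=\langle\mathbf{y}_r,\mathbf{y}_s\rangle\langle\mathbf{z}_r,\mathbf{z}_s\rangle,\quad(\Pi_Y)_{rs}=\langle\mathbf{x}_r,\mathbf{x}_s\rangle\langle\mathbf{z}_r,\mathbf{z}_s\rangle,\quad(\Pi_Z)_{rs}=\langle\mathbf{x}_r,\mathbf{x}_s\rangle\langle\mathbf{y}_r,\mathbf{y}_s\rangle,$$ $$(\Pi_{XY})_{rs}=\langle\mathbf{z}_r,\mathbf{z}_s\rangle,\quad(\Pi_{XZ})_{rs}=\langle\mathbf{y}_r,\mathbf{y}_s\rangle,\quad(\Pi_{YZ})_{rs}=\langle\mathbf{x}_r,\mathbf{x}_s\rangle.$$ *)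

(* Defs.v *)
From HB Require Import structures.
From mathcomp Require Import all_boot all_order all_algebra.
From mathcomp Require Import all_classical all_reals all_analysis.
Import Order.TTheory GRing.Theory Num.Theory.
Import numFieldNormedType.Exports.

Set Implicit Arguments.
Unset Strict Implicit.
Unset Printing Implicit Defensive.

Local Open Scope ring_scope.

(* [mxvec] is row-major, so [vec] stacks columns, the first one at the top. *)
Definition vec (R : realType) (a b : nat) (A : 'M[R]_(a, b)) : 'cV[R]_(b * a) :=
  (mxvec A^T)^T.

Definition unvec (R : realType) (a b : nat) (u : 'cV[R]_(b * a)) : 'M[R]_(a, b) :=
  (vec_mx u^T)^T.

Definition stack3 (R : realType) (a b c : nat)
    (u : 'cV[R]_a) (v : 'cV[R]_b) (w : 'cV[R]_c) : 'cV[R]_(a + b + c) :=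
  col_mx (col_mx u v) w.

Definition hadamard (R : realType) (a b : nat) (A B : 'M[R]_(a, b)) :
  'M[R]_(a, b) := map2_mx *%R A B.

Definition inner (R : realType) (a : nat) (u v : 'cV[R]_a) : R :=
  \sum_i u i 0 * v i 0.

(* [jacobian] is the matrix of the differential acting on row vectors from the
   right; the usual Jacobian of a map between column vectors is its transpose. *)
Definition Jacobian (R : realType) (N M : nat) (f : 'cV[R]_N -> 'cV[R]_M)
    (w : 'cV[R]_N) : 'M[R]_(M, N) :=
  (jacobian (fun u : 'rV[R]_N => (f u^T)^T) w^T)^T.

Section CPD.
Variables (R : realType) (m n p rk : nat).

(* rk m + rk n + rk p = rk (m + n + p), left undistributed so that the three
   blocks are visible in the type. *)
Definition params := 'cV[R]_(rk * m + rk * n + rk * p).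

Definition factorX (w : params) : 'M[R]_(m, rk) := unvec (usubmx (usubmx w)).
Definition factorY (w : params) : 'M[R]_(n, rk) := unvec (dsubmx (usubmx w)).
Definition factorZ (w : params) : 'M[R]_(p, rk) := unvec (dsubmx w).

Definition residual_entry (T : 'I_m -> 'I_n -> 'I_p -> R) (w : params)
    (i : 'I_m) (j : 'I_n) (k : 'I_p) : R :=
  T i j k - \sum_(r < rk) factorX w i r * factorY w j r * factorZ w k r.

(* Entries in lexicographic order of (i, j, k), see [residualE]. *)
Definition residual (T : 'I_m -> 'I_n -> 'I_p -> R) (w : params) :
    'cV[R]_(m * n * p) :=
  (mxvec (\matrix_(ij < m * n, k < p)
     mxvec (\matrix_(i < m, j < n) residual_entry T w i j k) 0 ij))^T.

Definition PiX (Y : 'M[R]_(n, rk)) (Z : 'M[R]_(p, rk)) : 'M[R]_rk :=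
  \matrix_(r, s) (inner (col r Y) (col s Y) * inner (col r Z) (col s Z)).
Definition PiY (X : 'M[R]_(m, rk)) (Z : 'M[R]_(p, rk)) : 'M[R]_rk :=
  \matrix_(r, s) (inner (col r X) (col s X) * inner (col r Z) (col s Z)).
Definition PiZ (X : 'M[R]_(m, rk)) (Y : 'M[R]_(n, rk)) : 'M[R]_rk :=
  \matrix_(r, s) (inner (col r X) (col s X) * inner (col r Y) (col s Y)).
Definition PiXY (Z : 'M[R]_(p, rk)) : 'M[R]_rk :=
  \matrix_(r, s) inner (col r Z) (col s Z).
Definition PiXZ (Y : 'M[R]_(n, rk)) : 'M[R]_rk :=
  \matrix_(r, s) inner (col r Y) (col s Y).
Definition PiYZ (X : 'M[R]_(m, rk)) : 'M[R]_rk :=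
  \matrix_(r, s) inner (col r X) (col s X).

Lemma residualE (T : 'I_m -> 'I_n -> 'I_p -> R) (w : params) i j k :
  residual T w (mxvec_index (mxvec_index i j) k) 0 = residual_entry T w i j k.
Proof. by rewrite mxE mxvecE mxE mxvecE mxE. Qed.

Lemma stack3_factors (w : params) :
  stack3 (vec (factorX w)) (vec (factorY w)) (vec (factorZ w)) = w.
Proof. by rewrite /stack3 /vec !trmxK !vec_mxK !trmxK !vsubmxK. Qed.

Lemma factors_stack3 (X : 'M[R]_(m, rk)) (Y : 'M[R]_(n, rk)) (Z : 'M[R]_(p, rk)) :
  let w := stack3 (vec X) (vec Y) (vec Z) in
  [/\ factorX w = X, factorY w = Y & factorZ w = Z].
Proof.
by move=> w; split; rewrite /factorX /factorY /factorZ /w /stack3 /unvec /vec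
  ?col_mxKu ?col_mxKd ?col_mxKu ?col_mxKd !trmxK mxvecK trmxK.
Qed.

End CPD.

Lemma JacobianE (R : realType) (N M : nat) (f : 'cV[R]_N -> 'cV[R]_M)
    (w : 'cV[R]_N) (a : 'I_M) (b : 'I_N) :
  differentiable (fun u : 'rV[R]_N => (f u^T)^T) w^T ->
  Jacobian f w a b = 'D_(delta_mx b 0) (fun u => f u a 0) w.
Proof.
move=> df; rewrite /Jacobian mxE.
have -> : jacobian (fun u : 'rV[R]_N => (f u^T)^T) w^T b a =
    ('D_(delta_mx 0 b) (fun u : 'rV[R]_N => (f u^T)^T) w^T) 0 a.
  by rewrite deriveEjacobian // -rowE [RHS]mxE.
rewrite derive_mx; last exact: diff_derivable.
rewrite mxE /derive.
suff -> : (fun h : R => h^-1 *: (((fun u : 'rV[R]_N => (f u^T)^T 0 a) \o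
     shift w^T) (h *: delta_mx 0 b) - (f w^T^T)^T 0 a)) =
  (fun h : R => h^-1 *: (((fun u => f u a 0) \o shift w) (h *: delta_mx b 0)
     - f w a 0)) by [].
apply/funext => h /=; rewrite !mxE trmxK.
by have -> : (h *: delta_mx 0 b + w^T)^T = h *: delta_mx b 0 + w
  by apply/matrixP => c d; rewrite !mxE (ord1 d) andbC.
Qed.

(* Main.v *)
(** The directional derivative of [residual] at (X, Y, Z) along (VX, VY, VZ) is
    minus the sum of the three rank-[rk] tensors obtained by replacing one
    factor by its direction.  The coordinate of A^T A v at an index b is the
    inner product of A e_b with A v, and the inner product of two tensors given
    by factor matrices is the sum of the entries of the Hadamard product of the
    cross Gram matrices; when the varied factor is a matrix unit, this sum is
    an entry of a product with Gram matrices. *)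
Require Import Defs.
From HB Require Import structures.
From mathcomp Require Import all_boot all_order all_algebra.
From mathcomp Require Import all_classical all_reals all_analysis.
From mathcomp Require Import ring.
Import Order.TTheory GRing.Theory Num.Theory.
Import numFieldNormedType.Exports.
Local Open Scope ring_scope.

Set Implicit Arguments.
Unset Strict Implicit.
Unset Printing Implicit Defensive.

(** * Jacobian products as directional derivatives, computed coordinate by coordinate *)

Lemma differentiable_rV (R : realType) (V : normedModType R) (M : nat)
    (F : V -> 'rV[R]_M) (x : V) :
  (forall a, differentiable (fun u => F u 0 a) x) -> differentiable F x.
Proof.
move=> dF.
(* Expanding on the standard basis leaves scalar functions multiplying constant vectors. *)
have -> : F = \sum_(a < M) (fun u => F u 0 a *: (delta_mx 0 a : 'rV[R]_M)).
  apply/funext => u; rewrite fct_sumE; exact: row_sum_delta.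
by apply: differentiable_sum => a; apply: differentiableZl.
Qed.

(** The differential applied to v is the derivative along v, so a product with the Jacobian can be
    computed without knowing the entries of the matrix. *)
Lemma Jacobian_mulE (R : realType) (N M : nat) (f : 'cV[R]_N -> 'cV[R]_M)
    (w v : 'cV[R]_N) (a : 'I_M) :
  (forall b, differentiable (fun u : 'rV[R]_N => f u^T b 0) w^T) ->
  (Jacobian f w *m v) a 0 = 'D_(v^T) (fun u : 'rV[R]_N => f u^T a 0) w^T.
Proof.
move=> df.
have dF : differentiable (fun u : 'rV[R]_N => (f u^T)^T) w^T.
  apply: differentiable_rV => b.
  by under eq_fun do rewrite mxE.
rewrite /Jacobian -[v in LHS]trmxK -trmx_mul -deriveEjacobian //.
rewrite derive_mx; last exact: diff_derivable.
by rewrite !mxE; under eq_fun do rewrite mxE.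
Qed.

(** Registered as an instance so that [derive_val] can differentiate any polynomial in the
    coordinates by instance resolution. *)
#[global] Instance is_derive_coord (R : realType) (a b : nat) (M v : 'M[R]_(a, b))
    (i : 'I_a) (j : 'I_b) :
  is_derive M v (fun N : 'M[R]_(a, b) => N i j : R) (v i j).
Proof.
split; first exact/diff_derivable/differentiable_coord.
have did : derivable (@id 'M[R]_(a, b)) M v by exact: derivable_id.
by have := derive_mx did; rewrite derive_id => /matrixP/(_ i j); rewrite mxE.
Qed.

(** * Inner products of tensors given by factor matrices *)

Definition cpd (R : realType) (m n p rk : nat) (X : 'M[R]_(m, rk))
    (Y : 'M[R]_(n, rk)) (Z : 'M[R]_(p, rk)) (i : 'I_m) (j : 'I_n) (k : 'I_p) : R :=
  \sum_(r < rk) X i r * Y j r * Z k r.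

Definition tdot (R : realType) (m n p : nat) (S T : 'I_m -> 'I_n -> 'I_p -> R) : R :=
  \sum_i \sum_j \sum_k S i j k * T i j k.

Lemma exchange_sum4 (V : nmodType) (I J K L : finType) (F : I -> J -> K -> L -> V) :
  \sum_i \sum_j \sum_k \sum_l F i j k l = \sum_l \sum_i \sum_j \sum_k F i j k l.
Proof.
rewrite [RHS]exchange_big; apply: eq_bigr => i _ /=.
rewrite [RHS]exchange_big; apply: eq_bigr => j _ /=.
by rewrite [RHS]exchange_big.
Qed.

Section CPD_dot.
Variables (R : realType) (m n p rk : nat).
Implicit Types (X : 'M[R]_(m, rk)) (Y : 'M[R]_(n, rk)) (Z : 'M[R]_(p, rk)).

Lemma cpd0X Y Z i j k : cpd (0 : 'M[R]_(m, rk)) Y Z i j k = 0.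
Proof. by rewrite /cpd big1 // => r _; rewrite mxE !mul0r. Qed.

Lemma cpd0Y X Z i j k : cpd X (0 : 'M[R]_(n, rk)) Z i j k = 0.
Proof. by rewrite /cpd big1 // => r _; rewrite mxE mulr0 mul0r. Qed.

Lemma cpd0Z X Y i j k : cpd X Y (0 : 'M[R]_(p, rk)) i j k = 0.
Proof. by rewrite /cpd big1 // => r _; rewrite mxE mulr0. Qed.

(** By bilinearity it is enough to pair rank-one tensors, and the inner product of two rank-one
    tensors splits into the product of the inner products of their three factors. *)
Lemma tdot_cpd X X' Y Y' Z Z' :
  tdot (cpd X Y Z) (cpd X' Y' Z') =
  \sum_r \sum_s (X^T *m X') r s * (Y^T *m Y') r s * (Z^T *m Z') r s.
Proof.
transitivity (\sum_i \sum_j \sum_k \sum_r \sum_s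
  (X i r * X' i s) * (Y j r * Y' j s) * (Z k r * Z' k s)).
  apply: eq_bigr => i _; apply: eq_bigr => j _; apply: eq_bigr => k _.
  rewrite /cpd big_distrl; apply: eq_bigr => r _ /=.
  by rewrite big_distrr; apply: eq_bigr => s _ /=; ring.
transitivity (\sum_r \sum_s \sum_i \sum_j \sum_k
  (X i r * X' i s) * (Y j r * Y' j s) * (Z k r * Z' k s)).
  (* The first exchange moves r outward, with the sum over s kept inside the summand; the second
     moves s. *)
  rewrite exchange_sum4; apply: eq_bigr => r _; exact: exchange_sum4.
apply: eq_bigr => r _; apply: eq_bigr => s _; rewrite !mxE.
rewrite big_distrl /= big_distrl /=; apply: eq_bigr => i _.
rewrite -[RHS]mulrA mulr_suml mulr_sumr; apply: eq_bigr => j _.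
rewrite [RHS]mulrA mulr_sumr; apply: eq_bigr => k _.
by rewrite !mxE.
Qed.

Lemma tr_mul_delta (a : nat) (X : 'M[R]_(a, rk)) (i : 'I_a) (s r t : 'I_rk) :
  (X^T *m delta_mx i s) r t = X i r * (t == s)%:R.
Proof.
rewrite mxE (bigD1 i) //= big1 => [|l /negPf li]; first by rewrite !mxE eqxx addr0.
by rewrite !mxE li mulr0.
Qed.

(** A matrix unit has a single nonzero column, so only the term t = s of the inner sum in [tdot_cpd]
    survives, and its first Gram entry is X i r. *)
Lemma tdot_cpd_deltaX X Y Y' Z Z' i s :
  tdot (cpd X Y Z) (cpd (delta_mx i s) Y' Z') =
  \sum_r X i r * ((Y^T *m Y') r s * (Z^T *m Z') r s).
Proof.
rewrite tdot_cpd; apply: eq_bigr => r _; rewrite (bigD1 s) //= big1 => [|t /negPf ts].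
  by rewrite tr_mul_delta eqxx mulr1 addr0 mulrA.
by rewrite tr_mul_delta ts mulr0 !mul0r.
Qed.

Lemma tdot_cpd_deltaY X X' Y Z Z' j s :
  tdot (cpd X Y Z) (cpd X' (delta_mx j s) Z') =
  \sum_r Y j r * ((X^T *m X') r s * (Z^T *m Z') r s).
Proof.
rewrite tdot_cpd; apply: eq_bigr => r _; rewrite (bigD1 s) //= big1 => [|t /negPf ts].
  by rewrite tr_mul_delta eqxx mulr1 addr0 mulrCA mulrA.
by rewrite tr_mul_delta ts mulr0 mulr0 mul0r.
Qed.

Lemma tdot_cpd_deltaZ X X' Y Y' Z k s :
  tdot (cpd X Y Z) (cpd X' Y' (delta_mx k s)) =
  \sum_r Z k r * ((X^T *m X') r s * (Y^T *m Y') r s).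
Proof.
rewrite tdot_cpd; apply: eq_bigr => r _; rewrite (bigD1 s) //= big1 => [|t /negPf ts].
  by rewrite tr_mul_delta eqxx mulr1 addr0 mulrC.
by rewrite tr_mul_delta ts mulr0 mulr0.
Qed.

End CPD_dot.

Lemma tdotDl (R : realType) (m n p : nat) (S S' T : 'I_m -> 'I_n -> 'I_p -> R) :
  tdot (fun i j k => S i j k + S' i j k) T = tdot S T + tdot S' T.
Proof.
rewrite /tdot -big_split; apply: eq_bigr => i _ /=.
rewrite -big_split; apply: eq_bigr => j _ /=.
by rewrite -big_split; apply: eq_bigr => k _ /=; rewrite mulrDl.
Qed.

(** * Index bookkeeping for vectorized matrices *)

Lemma sum_mxvec_index (R : realType) (a b : nat) (F : 'I_(a * b) -> R) :
  \sum_q F q = \sum_i \sum_j F (mxvec_index i j).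
Proof.
rewrite pair_bigA (reindex _ (curry_mxvec_bij a b)) /=.
by apply: eq_bigr => -[i j].
Qed.

Lemma vecD (R : realType) (a b : nat) (A B : 'M[R]_(a, b)) :
  vec (A + B) = vec A + vec B.
Proof. by rewrite /vec !linearD. Qed.

Lemma unvecE (R : realType) (a b : nat) (u : 'cV[R]_(b * a)) i s :
  unvec u i s = u (mxvec_index s i) 0.
Proof. by rewrite !mxE. Qed.

Lemma inner_col (R : realType) (a b : nat) (A : 'M[R]_(a, b)) r s :
  inner (col r A) (col s A) = (A^T *m A) r s.
Proof. by rewrite mxE; apply: eq_bigr => i _; rewrite !mxE. Qed.

(** [mxvec_index] is a cast of the rank of the pair in its enumeration, and both maps are
    injective. *)
Lemma eq_mxvec_index (a b : nat) (i i' : 'I_a) (j j' : 'I_b) :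
  (mxvec_index i j == mxvec_index i' j') = (i == i') && (j == j').
Proof.
by rewrite (inj_eq (@cast_ord_inj _ _ _)) (inj_eq enum_rank_inj).
Qed.

(** * The Jacobian of the residual map in block coordinates *)

Section ResidualJacobian.
Variables (R : realType) (m n p rk : nat) (T : 'I_m -> 'I_n -> 'I_p -> R).
Implicit Types w v : params R m n p rk.

(** The rank index comes first because [vec] stacks columns: each column of a factor is a contiguous
    slice. *)
Definition posX (s : 'I_rk) (i : 'I_m) : 'I_(rk * m + rk * n + rk * p) :=
  lshift _ (lshift _ (mxvec_index s i)).
Definition posY (s : 'I_rk) (j : 'I_n) : 'I_(rk * m + rk * n + rk * p) :=
  lshift _ (rshift _ (mxvec_index s j)).
Definition posZ (s : 'I_rk) (k : 'I_p) : 'I_(rk * m + rk * n + rk * p) :=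
  rshift _ (mxvec_index s k).

Lemma factorXE w i s : factorX w i s = w (posX s i) 0.
Proof. by rewrite unvecE !mxE. Qed.
Lemma factorYE w j s : factorY w j s = w (posY s j) 0.
Proof. by rewrite unvecE !mxE. Qed.
Lemma factorZE w k s : factorZ w k s = w (posZ s k) 0.
Proof. by rewrite unvecE !mxE. Qed.

(* Minus the derivative of [residual] at [w] in the direction [v]. *)
Definition dcpd w v (i : 'I_m) (j : 'I_n) (k : 'I_p) : R :=
  cpd (factorX v) (factorY w) (factorZ w) i j k
  + cpd (factorX w) (factorY v) (factorZ w) i j k
  + cpd (factorX w) (factorY w) (factorZ v) i j k.

(** Stated as an equality in the ring of functions, with coordinate functions as atoms: the form to
    which the differentiability lemmas and the derivative instances apply. *)
Lemma residual_entry_coord i j k :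
  (fun u => residual_entry T (u^T : params R m n p rk) i j k) =
  cst (T i j k) - \sum_(r < rk)
    ((fun u : 'rV[R]_(rk * m + rk * n + rk * p) => u 0 (posX r i)) *
     (fun u => u 0 (posY r j)) * (fun u => u 0 (posZ r k))).
Proof.
apply/funext => u; rewrite /residual_entry !fctE fct_sumE; congr (_ - _).
by apply: eq_bigr => r _; rewrite factorXE factorYE factorZE !mxE.
Qed.

Lemma differentiable_residual_entry w i j k :
  differentiable (fun u => residual_entry T (u^T : params R m n p rk) i j k) w^T.
Proof.
rewrite residual_entry_coord; apply: differentiableB => //.
apply: differentiable_sum => r.
by do 2?[apply: differentiableM]; apply: differentiable_coord.
Qed.

Lemma derive_residual_entry w v i j k :
  'D_(v^T) (fun u => residual_entry T (u^T : params R m n p rk) i j k) w^T =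
  - dcpd w v i j k.
Proof.
rewrite residual_entry_coord derive_val sub0r /dcpd -!big_split /=.
congr (- _); apply: eq_bigr => r _.
rewrite !factorXE !factorYE !factorZE !fctE !mxE /GRing.scale /=; ring.
Qed.

Lemma Jacobian_residual_mul w v i j k :
  (Jacobian (@residual R m n p rk T) w *m v) (mxvec_index (mxvec_index i j) k) 0 =
  - dcpd w v i j k.
Proof.
rewrite Jacobian_mulE => [|b].
  by rewrite -derive_residual_entry; under eq_fun do rewrite residualE.
case/mxvec_indexP: b => ij k'; case/mxvec_indexP: ij => i' j'.
under eq_fun do rewrite residualE.
exact: differentiable_residual_entry.
Qed.

Lemma JtJ_mulE w v b :
  let J := Jacobian (@residual R m n p rk T) w in
  (J^T *m J *m v) b 0 = tdot (dcpd w v) (dcpd w (delta_mx b 0)).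
Proof.
move=> J; rewrite -mulmxA mxE !sum_mxvec_index.
apply: eq_bigr => i _; apply: eq_bigr => j _; apply: eq_bigr => k _.
(* Row b of the transpose is J applied to the basis vector at b, so both factors are directional
   derivatives and their minus signs cancel. *)
have JTE q : J^T b q = (J *m (delta_mx b 0 : params R m n p rk)) q 0.
  by rewrite -colE !mxE.
by rewrite JTE !Jacobian_residual_mul mulrNN mulrC.
Qed.

Lemma factor_delta_posX s i :
  let e : params R m n p rk := delta_mx (posX s i) 0 in
  [/\ factorX e = delta_mx i s, factorY e = 0 & factorZ e = 0].
Proof.
split; apply/matrixP => a t;
  rewrite ?factorXE ?factorYE ?factorZE !mxE eqxx andbT /posX /posY /posZ;
  (* Positions in different blocks are distinct by [eq_shift]; within a block, the order (rank, row)
     of a position is swapped to match [delta_mx]. *)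
  by rewrite ?eq_shift ?eq_mxvec_index // andbC.
Qed.

Lemma factor_delta_posY s j :
  let e : params R m n p rk := delta_mx (posY s j) 0 in
  [/\ factorX e = 0, factorY e = delta_mx j s & factorZ e = 0].
Proof.
split; apply/matrixP => a t;
  rewrite ?factorXE ?factorYE ?factorZE !mxE eqxx andbT /posX /posY /posZ;
  by rewrite ?eq_shift ?eq_mxvec_index // andbC.
Qed.

Lemma factor_delta_posZ s k :
  let e : params R m n p rk := delta_mx (posZ s k) 0 in
  [/\ factorX e = 0, factorY e = 0 & factorZ e = delta_mx k s].
Proof.
split; apply/matrixP => a t;
  rewrite ?factorXE ?factorYE ?factorZE !mxE eqxx andbT /posX /posY /posZ;
  by rewrite ?eq_shift ?eq_mxvec_index // andbC.
Qed.

Lemma params_ext w v :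
  factorX w = factorX v -> factorY w = factorY v -> factorZ w = factorZ v -> w = v.
Proof. by move=> eX eY eZ; rewrite -(stack3_factors w) eX eY eZ stack3_factors. Qed.

Lemma dcpd_delta_posX w s i :
  dcpd w (delta_mx (posX s i) 0) = cpd (delta_mx i s) (factorY w) (factorZ w).
Proof.
have [eX eY eZ] := factor_delta_posX s i.
do 3 apply/funext => ?; by rewrite /dcpd eX eY eZ cpd0Y cpd0Z !addr0.
Qed.

Lemma dcpd_delta_posY w s j :
  dcpd w (delta_mx (posY s j) 0) = cpd (factorX w) (delta_mx j s) (factorZ w).
Proof.
have [eX eY eZ] := factor_delta_posY s j.
do 3 apply/funext => ?; by rewrite /dcpd eX eY eZ cpd0X cpd0Z add0r addr0.
Qed.

Lemma dcpd_delta_posZ w s k :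
  dcpd w (delta_mx (posZ s k) 0) = cpd (factorX w) (factorY w) (delta_mx k s).
Proof.
have [eX eY eZ] := factor_delta_posZ s k.
do 3 apply/funext => ?; by rewrite /dcpd eX eY eZ cpd0X cpd0Y !add0r.
Qed.

(** Arbitrary factors let one lemma serve [PiX], [PiY] and [PiZ], which all unfold to this
    matrix. *)
Lemma mul_PiE (a b c : nat) (V : 'M[R]_(a, rk)) (B : 'M[R]_(b, rk))
    (C : 'M[R]_(c, rk)) i s :
  (V *m \matrix_(r, t) (inner (col r B) (col t B) * inner (col r C) (col t C))) i s =
  \sum_r V i r * ((B^T *m B) r s * (C^T *m C) r s).
Proof. by rewrite mxE; apply: eq_bigr => r _; rewrite mxE !inner_col. Qed.

Lemma mul_hadamardE (a b : nat) (A : 'M[R]_(a, rk)) (B : 'M[R]_(b, rk))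
    (M : 'M[R]_rk) i s :
  (A *m hadamard (\matrix_(r, t) inner (col r B) (col t B)) M) i s =
  \sum_r A i r * ((B^T *m B) r s * M r s).
Proof.
by rewrite mxE; apply: eq_bigr => r _; rewrite [hadamard _ _ _ _]mxE mxE inner_col.
Qed.

End ResidualJacobian.

Theorem theorem4p6 (R : realType) (m n p rk : nat)
    (hm : (0 < m)%N) (hn : (0 < n)%N) (hp : (0 < p)%N) (hrk : (0 < rk)%N)
    (T : 'I_m -> 'I_n -> 'I_p -> R)
    (w : 'cV[R]_(rk * m + rk * n + rk * p))
    (X : 'M[R]_(m, rk)) (Y : 'M[R]_(n, rk)) (Z : 'M[R]_(p, rk))
    (hw : w = stack3 (vec X) (vec Y) (vec Z))
    (v : 'cV[R]_(rk * m + rk * n + rk * p))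
    (VX : 'M[R]_(m, rk)) (VY : 'M[R]_(n, rk)) (VZ : 'M[R]_(p, rk))
    (hv : v = stack3 (vec VX) (vec VY) (vec VZ)) :
  let A := Jacobian (@residual R m n p rk T) w in
  (A^T *m A) *m v =
  stack3
    (vec (VX *m PiX Y Z)
     + vec (X *m hadamard (PiXY Z) (VY^T *m Y))
     + vec (X *m hadamard (PiXZ Y) (VZ^T *m Z)))
    (vec (Y *m hadamard (PiXY Z) (VX^T *m X))
     + vec (VY *m PiY X Z)
     + vec (Y *m hadamard (PiYZ X) (VZ^T *m Z)))
    (vec (Z *m hadamard (PiXZ Y) (VX^T *m X))
     + vec (Z *m hadamard (PiYZ X) (VY^T *m Y))
     + vec (VZ *m PiZ X Y)).
Proof.
move=> A; have [wX wY wZ] := factors_stack3 X Y Z.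
have [vX vY vZ] := factors_stack3 VX VY VZ.
rewrite -hw in wX wY wZ; rewrite -hv in vX vY vZ.
(* Merging each block into a single [vec] lets [factors_stack3] read the right-hand side, which
   leaves one matrix identity per factor. *)
rewrite -!vecD.
set BX := (X in vec X); set BY := (X in stack3 _ (vec X)).
set BZ := (X in stack3 _ _ (vec X)).
have [eX eY eZ] := factors_stack3 BX BY BZ.
apply: (@params_ext R m n p rk); rewrite ?eX ?eY ?eZ; apply/matrixP => a s;
  rewrite ?factorXE ?factorYE ?factorZE JtJ_mulE !tdotDl.
- rewrite dcpd_delta_posX wX wY wZ vX vY vZ !tdot_cpd_deltaX.
  rewrite /BX [RHS]mxE [X in _ = X + _]mxE; congr (_ + _ + _).
  + by rewrite mul_PiE.
  (* [tdot_cpd_deltaX] lists the Y Gram entry before the Z one, whereas the Hadamard product starts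
     with [PiXY], hence the commutation. *)
  + by rewrite mul_hadamardE; apply: eq_bigr => r _; congr (_ * _); exact: mulrC.
  + by rewrite mul_hadamardE.
- rewrite dcpd_delta_posY wX wY wZ vX vY vZ !tdot_cpd_deltaY.
  rewrite /BY [RHS]mxE [X in _ = X + _]mxE; congr (_ + _ + _).
  + by rewrite mul_hadamardE; apply: eq_bigr => r _; congr (_ * _); exact: mulrC.
  + by rewrite mul_PiE.
  + by rewrite mul_hadamardE.
- rewrite dcpd_delta_posZ wX wY wZ vX vY vZ !tdot_cpd_deltaZ.
  rewrite /BZ [RHS]mxE [X in _ = X + _]mxE; congr (_ + _ + _).
  + by rewrite mul_hadamardE; apply: eq_bigr => r _; congr (_ * _); exact: mulrC.
  + by rewrite mul_hadamardE.
  + by rewrite mul_PiE.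
Qed.
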